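(* For $t\in\left[-\frac{2\pi}3,\frac{2\pi}3\right]$ (with $t\neq\pm\frac{\pi}{2}$), parametric equations of the edge of regression $\mathcal{R}$ of the extended oloid $\mathcal{O}$ are given by $$x=g_1(t)=\frac{\sin t-\tan t}{3},\qquad y=g_2(t)=\frac{2+3\cos t-3\cos^2t-2\cos^3t}{6(1+\cos t)\cos t},$$ $$z=g_3(t)=\pm\frac{(1+2\cos t)^{3/2}}{3(1+\cos t)\cos t}.$$
   Context: Let $k_A=\{(x,y,z)\in\mathbb{R}^3: x^2+(y+\frac12)^2=1,\ z=0\}$ and $k_B=\{(x,y,z)\in\mathbb{R}^3: (y-\frac12)^2+z^2=1,\ x=0\}$. The extended oloid $\mathcal{O}$ is the developable surface containing the surface of the convex hull of $k_A\cup k_B$; it is the union of the generating lines $x=\omega_1(m,t)$, $y=\omega_2(m,t)$, $z=\pm\omega_3(m,t)$, $m\in\mathbb{R}$, for $t\in[-\frac{2\pi}3,\frac{2\pi}3]$, where $$\omega_1=(1-m)\sin t,\quad \omega_2=(1-m)\left(-\tfrac12-\cos t\right)+m\left(\tfrac12-\tfrac{\cos t}{1+\cos t}\right),\quad \omega_3=\frac{m\sqrt{1+2\cos t}}{1+\cos t}.$$ The edge of regression $\mathcal{R}$ of the developable surface $\mathcal{O}$ is the curve to which all generating lines of $\mathcal{O}$ are tangent (the locus of the singular points on the generating lines). *)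

(* Defs.v *)
From Stdlib Require Import Reals Lra.
From Coquelicot Require Import Coquelicot.
Open Scope R_scope.

Definition point : Type := (R * R * R)%type.

Definition px (p : point) : R := fst (fst p).
Definition py (p : point) : R := snd (fst p).
Definition pz (p : point) : R := snd p.

Definition vzero : point := (0, 0, 0).
Definition vadd (p q : point) : point := (px p + px q, py p + py q, pz p + pz q).
Definition vsub (p q : point) : point := (px p - px q, py p - py q, pz p - pz q).
Definition vscal (m : R) (p : point) : point := (m * px p, m * py p, m * pz p).
Definition cross (p q : point) : point :=
  (py p * pz q - pz p * py q,
   pz p * px q - px p * pz q,
   px p * py q - py p * px q).
Definition vnorm (p : point) : R := sqrt (px p ^ 2 + py p ^ 2 + pz p ^ 2).

Definition vDerive (a : R -> point) (u : R) : point :=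
  (Derive (fun v => px (a v)) u,
   Derive (fun v => py (a v)) u,
   Derive (fun v => pz (a v)) u).

Definition C1_near (f : R -> R) (u0 : R) : Prop :=
  locally u0 (fun u => ex_derive f u /\ continuous (Derive f) u).
Definition vC1_near (a : R -> point) (u0 : R) : Prop :=
  C1_near (fun u => px (a u)) u0 /\
  C1_near (fun u => py (a u)) u0 /\
  C1_near (fun u => pz (a u)) u0.

Definition line (a b : point) : point -> Prop :=
  fun p => exists m : R, p = vadd a (vscal m b).

(** A ruled surface is given by the set [F] of its generating lines.
    [local_ruling F L a b]: the map [(u, m) |-> a u + m * b u] is, for [u] near
    0, a C^1 ruled parametrization of the surface whose line at [u = 0] is [L].
    Nothing is required of its rank. *)
Definition local_ruling (F : (point -> Prop) -> Prop) (L : point -> Prop)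
    (a b : R -> point) : Prop :=
  vC1_near a 0 /\ vC1_near b 0 /\
  locally 0 (fun u => b u <> vzero /\ F (line (a u) (b u))) /\
  (forall p, line (a 0) (b 0) p <-> L p).

(** [p] is a singular point on the generating line [L]: no C^1 ruled
    parametrization through [L] is an immersion at [p], i.e. the partial
    derivatives [a' + m b'] (along [u]) and [b] (along [m]) are always linearly
    dependent there.  Quantifying over the parametrizations, rather than fixing
    one, is what gives the notion a meaning on the lines [t = +- 2 PI / 3] of
    the oloid, where [omega3] below is not differentiable in [t] although its
    two sheets join smoothly.  Transversal self-intersections of the surface
    do not count as singular, since [L] is fixed. *)
Definition singular_point (F : (point -> Prop) -> Prop) (L : point -> Prop)
    (p : point) : Prop :=
  L p /\
  forall (a b : R -> point) (m : R),
    local_ruling F L a b ->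
    p = vadd (a 0) (vscal m (b 0)) ->
    cross (vadd (vDerive a 0) (vscal m (vDerive b 0))) (b 0) = vzero.

Definition edge_of_regression (F : (point -> Prop) -> Prop) : point -> Prop :=
  fun p => exists L, F L /\ singular_point F L p.

(** [L] is tangent at [t0] to the curve [c] with parameter domain [D]: [L] is
    the limit position of the secants through [c t0] and [c t].  Secants rather
    than the derivative, because an edge of regression may have cusps, where the
    velocity vanishes (here at [t = 0]). *)
Definition tangent_line (D : R -> Prop) (c : R -> point) (t0 : R)
    (L : point -> Prop) : Prop :=
  exists d : point, d <> vzero /\
    (forall p, L p <-> line (c t0) d p) /\
    forall eps, 0 < eps -> exists delta, 0 < delta /\
      forall t, D t -> 0 < Rabs (t - t0) < delta ->
        c t <> c t0 /\
        vnorm (cross (vsub (c t) (c t0)) d) <= eps * vnorm (vsub (c t) (c t0)).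

Definition omega1 (m t : R) : R := (1 - m) * sin t.
Definition omega2 (m t : R) : R :=
  (1 - m) * (- (1 / 2) - cos t) + m * (1 / 2 - cos t / (1 + cos t)).
Definition omega3 (m t : R) : R := m * sqrt (1 + 2 * cos t) / (1 + cos t).

(** [e] is [1] or [-1], the sign of the third coordinate. *)
Definition generator (e t : R) : point -> Prop :=
  fun p => exists m : R, p = (omega1 m t, omega2 m t, e * omega3 m t).

(** The extended oloid, as the set of its generating lines. *)
Definition extended_oloid (L : point -> Prop) : Prop :=
  exists e t : R, (e = 1 \/ e = -1) /\
    - (2 * PI / 3) <= t <= 2 * PI / 3 /\
    (forall p, L p <-> generator e t p).

Definition g1 (t : R) : R := (sin t - tan t) / 3.
Definition g2 (t : R) : R :=
  (2 + 3 * cos t - 3 * cos t ^ 2 - 2 * cos t ^ 3) / (6 * (1 + cos t) * cos t).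
(** [sqrt x ^ 3] is [x] to the power 3/2; [Rpower] is wrong at [x = 0], which is
    attained at [t = +- 2 PI / 3]. *)
Definition g3 (t : R) : R :=
  sqrt (1 + 2 * cos t) ^ 3 / (3 * (1 + cos t) * cos t).

Definition g (e t : R) : point := (g1 t, g2 t, e * g3 t).

Definition g_domain (t : R) : Prop :=
  - (2 * PI / 3) <= t <= 2 * PI / 3 /\ t <> PI / 2 /\ t <> - (PI / 2).

(* Main.v *)
Require Import Defs.
From Stdlib Require Import Reals Lra.
From Coquelicot Require Import Coquelicot.
Open Scope R_scope.
Set Bullet Behavior "Strict Subproofs".

(** The generating lines are parametrized, smoothly and without exception, by
    the points [(c, n, s)] of the space curve [c^2 + n^2 = 1], [s^2 = 1 + 2 c],
    where [c = cos t], [n = sin t] and [s = +- sqrt (1 + 2 cos t)].  At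
    [t = +- 2 PI / 3] the square root is not differentiable in [t], but [s] is a
    regular coordinate on this curve, and the two sheets join there.  No
    generating line is parallel to the plane [y = 0], so each is the graph of
    an affine map of [y], called [ruling] below.

    Along the curve every velocity is a multiple [tau] of [(n s, - c s, n)], a
    field that never vanishes.  Differentiating [ruling] in this direction
    gives, for any C^1 ruling [(u, m) |-> a u + m * b u] by these lines,
    [(a' + m b') x b = k * (n, - c, s)], where [(n, - c, s)] is normal to the
    surface, constant along the line because the surface is developable, and
    where [k] is [tau * py b * regression_defect c y] up to a nonzero factor
    ([cross_partial_derivatives]).

    - Hence a point with [regression_defect c y = 0] is singular.  To apply the
      formula to an arbitrary C^1 ruling, [c], [n] and [s] must be differentiable
      functions of [u]: they are rational in the coordinates of [a] and [b]
      ([ruling_parameters_differentiable]).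
    - Conversely, a local parameter of the curve yields a ruling with [tau] and
      [py b] nonzero ([oloid_curve_chart]), so a singular point has defect 0.

    The defect is affine in [y].  For [c = 0] it is the constant 2, so the lines
    [t = +- PI / 2] carry no singular point.  Otherwise it vanishes exactly at
    [y = g2 t], and the point of the line at that height is [g e t].

    For the tangents, the coordinates of [g e t] are, up to the sign of [sin t],
    functions of [c = cos t] alone, of the form [r^(3/2) / (3 c (1 + c))] for
    [x] (with [r = 1 - c^2]) and for [z] (with [r = 1 + 2 c]).  As [r^(3/2)] is
    differentiable even at [r = 0], they are differentiable in [c] also at the
    cusp [t = 0] and at the ends [t = +- 2 PI / 3].  Since [dy/dc] never
    vanishes and [(dx/dc, dy/dc, dz/dc)] is parallel to the line, secants of
    the curve converge to the line. *)

(** * The generating lines *)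

Definition oloid_curve (c n s : R) : Prop := c ^ 2 + n ^ 2 = 1 /\ s ^ 2 = 1 + 2 * c.

(** A point [(c, n, s)] of the oloid curve has its line through [(n, - 1/2 - c, 0)]
    on the first circle with direction [(- n (1 + c), q c, s)]. *)
Definition q (c : R) : R := 1 + c + c ^ 2.

(** Homogeneous form: for [k = 1] this is the point at height [y] of the line
    of parameters [(c, n, s)], for [k = 0] the direction of that line with second
    coordinate [y].  It is linear in [(k, y)], so [a + m b] is again a [ruling]. *)
Definition ruling (c n s k y : R) : point :=
  (n * (k * (1 - c) / 2 - y * (1 + c)) / q c, y,
   s * (k * (1 + 2 * c) / 2 + y) / q c).

(** The factor by which a ruling fails to be an immersion at height [y]. *)
Definition regression_defect (c y : R) : R :=
  (1 + 2 * c) * (1 - c) * (2 + c) - 6 * c * (1 + c) * y.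

Lemma q_pos c : 0 < q c.
Proof. unfold q; nra. Qed.

Lemma oloid_curve_bounds c n s : oloid_curve c n s -> - (1 / 2) <= c <= 1.
Proof. intros [H1 H2]; split; nra. Qed.

Lemma point_eq (p p' : point) :
  px p = px p' -> py p = py p' -> pz p = pz p' -> p = p'.
Proof.
  destruct p as [[x y] z], p' as [[x' y'] z']; unfold px, py, pz; simpl.
  now intros -> -> ->.
Qed.

Ltac coordinates :=
  apply point_eq; unfold ruling, cross, vadd, vsub, vscal, px, py, pz;
  cbn [fst snd].

Lemma line_ruling c n s ya yb p :
  yb <> 0 ->
  line (ruling c n s 1 ya) (ruling c n s 0 yb) p <-> p = ruling c n s 1 (py p).
Proof.
  intros Hyb; pose proof (q_pos c) as Hq; split.
  - intros [m ->]; coordinates; field; lra.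
  - intros Hp; set (y := py p) in Hp; clearbody y; subst p; exists ((y - ya) / yb).
    coordinates; field; lra.
Qed.

(** It suffices to look at the points [a] and [a + b] of the line. *)
Lemma line_in_ruling c n s a b :
  (forall p, line a b p -> p = ruling c n s 1 (py p)) ->
  a = ruling c n s 1 (py a) /\ b = ruling c n s 0 (py b).
Proof.
  intros H; pose proof (q_pos c) as Hq.
  assert (Ha : a = ruling c n s 1 (py a)).
  { apply H; exists 0; coordinates; ring. }
  split; [exact Ha|].
  assert (Hab : vadd a (vscal 1 b) = ruling c n s 1 (py (vadd a (vscal 1 b)))).
  { apply H; now exists 1. }
  assert (Hx := f_equal px Hab); assert (Hz := f_equal pz Hab).
  assert (Hx' := f_equal px Ha); assert (Hz' := f_equal pz Ha).
  unfold ruling, vadd, vscal, px, py, pz in *; cbn [fst snd] in *.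
  coordinates.
  - replace (fst (fst b)) with
      (fst (fst a) + 1 * fst (fst b) - fst (fst a)) by ring.
    rewrite Hx, Hx' at 1; field; lra.
  - reflexivity.
  - replace (snd b) with (snd a + 1 * snd b - snd a) by ring.
    rewrite Hz, Hz' at 1; field; lra.
Qed.

Lemma cos_range t : - (2 * PI / 3) <= t <= 2 * PI / 3 -> - (1 / 2) <= cos t.
Proof.
  intros Ht; pose proof PI_RGT_0 as Hpi.
  assert (Hc : cos (2 * (PI / 3)) = - (1 / 2)) by (rewrite cos_2PI3; lra).
  assert (Hpos : forall v, 0 <= v <= 2 * PI / 3 -> - (1 / 2) <= cos v).
  { intros v Hv; rewrite <- Hc; apply cos_decr_1; lra. }
  destruct (Rle_dec 0 t).
  - apply Hpos; lra.
  - rewrite <- cos_neg; apply Hpos; lra.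
Qed.

Lemma oloid_curve_param e t :
  (e = 1 \/ e = -1) -> - (2 * PI / 3) <= t <= 2 * PI / 3 ->
  oloid_curve (cos t) (sin t) (e * sqrt (1 + 2 * cos t)).
Proof.
  intros He Ht; pose proof (cos_range t Ht) as Hc; split.
  - pose proof (sin2_cos2 t) as H; unfold Rsqr in H; nra.
  - rewrite Rpow_mult_distr, pow2_sqrt by lra.
    destruct He as [-> | ->]; ring.
Qed.

(** The parameters are recovered as [t = +- acos c], with the sign of [n], and
    [e] the sign of [s]; [c >= - 1/2] is what keeps [t] in the interval. *)
Lemma oloid_curve_surj c n s :
  oloid_curve c n s ->
  exists e t, (e = 1 \/ e = -1) /\ - (2 * PI / 3) <= t <= 2 * PI / 3 /\
    cos t = c /\ sin t = n /\ e * sqrt (1 + 2 * cos t) = s.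
Proof.
  intros H; pose proof (oloid_curve_bounds _ _ _ H) as Hb.
  destruct H as [H1 H2]; pose proof PI_RGT_0 as Hpi.
  assert (Hs : exists e, (e = 1 \/ e = -1) /\ e * sqrt (1 + 2 * c) = s).
  { rewrite <- H2, <- Rsqr_pow2, sqrt_Rsqr_abs.
    destruct (Rle_dec 0 s).
    - exists 1; split; [now left|]; rewrite Rabs_right; lra.
    - exists (-1); split; [now right|]; rewrite Rabs_left; lra. }
  destruct Hs as [e [He Hs]].
  pose proof (acos_bound c) as Ha.
  assert (Hcos : cos (acos c) = c) by (apply cos_acos; lra).
  assert (Ha' : acos c <= 2 * PI / 3).
  { destruct (Rle_dec (acos c) (2 * PI / 3)) as [|Hn]; [assumption|exfalso].
    assert (Hd : cos (acos c) < cos (2 * (PI / 3)))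
      by (apply cos_decreasing_1; lra).
    rewrite cos_2PI3 in Hd; lra. }
  assert (Hsin : sin (acos c) = Rabs n).
  { rewrite sin_acos by lra.
    replace (1 - c²) with (n²) by (unfold Rsqr; nra).
    apply sqrt_Rsqr_abs. }
  destruct (Rle_dec 0 n).
  - exists e, (acos c); rewrite Hcos, Hsin, Rabs_right by lra.
    repeat split; auto; lra.
  - exists e, (- acos c); rewrite cos_neg, sin_neg, Hcos, Hsin, Rabs_left by lra.
    repeat split; auto; lra.
Qed.

Lemma generator_ruling e t p :
  - (2 * PI / 3) <= t <= 2 * PI / 3 ->
  (e = 1 \/ e = -1) ->
  generator e t p <->
  p = ruling (cos t) (sin t) (e * sqrt (1 + 2 * cos t)) 1 (py p).
Proof.
  intros Ht He; pose proof (oloid_curve_param e t He Ht) as [_ H2].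
  pose proof (cos_range t Ht) as Hc; pose proof (q_pos (cos t)) as Hq.
  unfold generator, omega1, omega2, omega3, q in *.
  set (c := cos t) in *; set (n := sin t); set (r := sqrt (1 + 2 * c)) in *.
  split.
  - intros [m ->]; coordinates; unfold q; field; lra.
  - intros Hp; set (y := py p) in Hp; clearbody y; subst p.
    exists ((y + 1 / 2 + c) * (1 + c) / q c).
    coordinates; unfold q; field; lra.
Qed.

(** Replaces the pair of a sign and an angle, which is singular at the ends of
    the interval, by a point of the smooth curve. *)
Lemma extended_oloid_ruling (L : point -> Prop) :
  extended_oloid L <->
  exists c n s, oloid_curve c n s /\ forall p, L p <-> p = ruling c n s 1 (py p).
Proof.
  split.
  - intros [e [t [He [Ht HL]]]].
    exists (cos t), (sin t), (e * sqrt (1 + 2 * cos t)).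
    split; [now apply oloid_curve_param|].
    intros p; rewrite HL; now apply generator_ruling.
  - intros [c [n [s [H HL]]]].
    destruct (oloid_curve_surj c n s H) as [e [t [He [Ht [Hc [Hn Hs]]]]]].
    exists e, t; repeat split; try tauto.
    + intros Hp; apply generator_ruling; auto.
      rewrite Hs, Hc, Hn; now apply HL.
    + intros Hp; apply generator_ruling in Hp; auto.
      rewrite Hs, Hc, Hn in Hp; now apply HL.
Qed.

(** * The rank of a ruling *)

Lemma is_derive_ruling_x (c n y : R -> R) k c' n' y' :
  is_derive c 0 c' -> is_derive n 0 n' -> is_derive y 0 y' ->
  is_derive (fun u => n u * (k * (1 - c u) / 2 - y u * (1 + c u)) / q (c u)) 0
    ((n' * (k * (1 - c 0) / 2 - y 0 * (1 + c 0))
      + n 0 * (- k * c' / 2 - y' * (1 + c 0) - y 0 * c')) / q (c 0)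
     - n 0 * (k * (1 - c 0) / 2 - y 0 * (1 + c 0)) * ((1 + 2 * c 0) * c') / q (c 0) ^ 2).
Proof.
  intros Hc Hn Hy; pose proof (q_pos (c 0)) as Hq; unfold q in *.
  auto_derive.
  - repeat split; try (eexists; eassumption); lra.
  - rewrite (is_derive_unique (fun x : R => c x) _ _ Hc),
      (is_derive_unique (fun x : R => n x) _ _ Hn),
      (is_derive_unique (fun x : R => y x) _ _ Hy); field; lra.
Qed.

Lemma is_derive_ruling_z (c s y : R -> R) k c' s' y' :
  is_derive c 0 c' -> is_derive s 0 s' -> is_derive y 0 y' ->
  is_derive (fun u => s u * (k * (1 + 2 * c u) / 2 + y u) / q (c u)) 0
    ((s' * (k * (1 + 2 * c 0) / 2 + y 0) + s 0 * (k * c' + y')) / q (c 0)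
     - s 0 * (k * (1 + 2 * c 0) / 2 + y 0) * ((1 + 2 * c 0) * c') / q (c 0) ^ 2).
Proof.
  intros Hc Hn Hy; pose proof (q_pos (c 0)) as Hq; unfold q in *.
  auto_derive.
  - repeat split; try (eexists; eassumption); lra.
  - rewrite (is_derive_unique (fun x : R => c x) _ _ Hc),
      (is_derive_unique (fun x : R => s x) _ _ Hn),
      (is_derive_unique (fun x : R => y x) _ _ Hy); field; lra.
Qed.

Lemma vDerive_ruling (v : R -> point) (c n s : R -> R) k c' n' s' :
  locally 0 (fun u => v u = ruling (c u) (n u) (s u) k (py (v u))) ->
  ex_derive (fun u => py (v u)) 0 ->
  is_derive c 0 c' -> is_derive n 0 n' -> is_derive s 0 s' ->
  vDerive v 0 =
    (let y := py (v 0) in let y' := Derive (fun u => py (v u)) 0 in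
     ((n' * (k * (1 - c 0) / 2 - y * (1 + c 0))
      + n 0 * (- k * c' / 2 - y' * (1 + c 0) - y * c')) / q (c 0)
     - n 0 * (k * (1 - c 0) / 2 - y * (1 + c 0)) * ((1 + 2 * c 0) * c') / q (c 0) ^ 2,
     y',
     (s' * (k * (1 + 2 * c 0) / 2 + y) + s 0 * (k * c' + y')) / q (c 0)
     - s 0 * (k * (1 + 2 * c 0) / 2 + y) * ((1 + 2 * c 0) * c') / q (c 0) ^ 2)).
Proof.
  intros Hv Hy Hc Hn Hs; apply Derive_correct in Hy; cbv zeta.
  unfold vDerive; apply f_equal2; [apply f_equal2|].
  - apply is_derive_unique.
    eapply is_derive_ext_loc; [|exact (is_derive_ruling_x c n _ k _ _ _ Hc Hn Hy)].
    revert Hv; apply filter_imp; intros u ->; reflexivity.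
  - reflexivity.
  - apply is_derive_unique.
    eapply is_derive_ext_loc; [|exact (is_derive_ruling_z c s _ k _ _ _ Hc Hs Hy)].
    revert Hv; apply filter_imp; intros u ->; reflexivity.
Qed.

(** Modulo [b], the derivative of [a + m b] is [tau * w * (- s, 0, n)] with [w] a
    multiple of the defect: both other components contain the same factor
    [w].  This coincidence is developability, and the cross product with the
    direction [(- n (1 + c), q c, s)] is then along [(n, - c, s)]. *)
Lemma cross_partial_derivatives (a b : R -> point) (c n s : R -> R) (m tau : R) :
  oloid_curve (c 0) (n 0) (s 0) ->
  locally 0 (fun u => a u = ruling (c u) (n u) (s u) 1 (py (a u))) ->
  locally 0 (fun u => b u = ruling (c u) (n u) (s u) 0 (py (b u))) ->
  ex_derive (fun u => py (a u)) 0 -> ex_derive (fun u => py (b u)) 0 ->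
  is_derive c 0 (tau * (n 0 * s 0)) -> is_derive n 0 (tau * (- c 0 * s 0)) ->
  is_derive s 0 (tau * n 0) ->
  cross (vadd (vDerive a 0) (vscal m (vDerive b 0))) (b 0) =
  vscal (- tau * py (b 0) * regression_defect (c 0) (py (a 0) + m * py (b 0))
         / (2 * q (c 0) ^ 2))
    (n 0, - c 0, s 0).
Proof.
  intros H Ha Hb Hya Hyb Hc Hn Hs.
  rewrite (locally_singleton _ _ Hb) at 1.
  rewrite (vDerive_ruling a c n s 1 _ _ _ Ha Hya Hc Hn Hs).
  rewrite (vDerive_ruling b c n s 0 _ _ _ Hb Hyb Hc Hn Hs); cbv zeta.
  set (ya := py (a 0)); set (yb := py (b 0)).
  set (ya' := Derive _ _); set (yb' := Derive _ _).
  clearbody ya yb ya' yb'; clear Ha Hb Hya Hyb Hc Hn Hs a b.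
  destruct H as [H1 H2]; pose proof (q_pos (c 0)) as Hq.
  revert H1 H2 Hq; generalize (c 0), (n 0), (s 0); clear c n s; intros c n s H1 H2 Hq.
  assert (Hn2 : n ^ 2 = 1 - c ^ 2) by lra.
  unfold regression_defect, ruling, cross, vadd, vscal, q in *.
  coordinates.
  - field_simplify_eq; [|lra].
    ring [Hn2 H2].
  - field_simplify_eq; [|lra]. ring [Hn2 H2].
  - field_simplify_eq; [|lra]. ring [Hn2 H2].
Qed.

(** * Differentiability of the parameters of a moving line *)

(** The line through [a] with direction [b] meets [y = 0] at a point [(xi, 0, zeta)].
    On the oloid, [- bx / by = (n / q) (1 + c)], [xi = (n / q) (1 - c) / 2],
    [bz / by = s / q] and [zeta = (s / q) (1 + 2 c) / 2].  These give
    [n / q], [s / q] and their products with [c]; dividing needs one of [n / q]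
    and [s / q] to be nonzero, whence the sum of squares in [line_cos], which
    avoids a choice between the two. *)
Definition line_n_over_q (a b : point) : R := (2 * (px a - py a * (px b / py b)) - px b / py b) / 2.
Definition line_s_over_q (b : point) : R := pz b / py b.
Definition line_cos (a b : point) : R :=
  (line_n_over_q a b * (- (px b / py b) - line_n_over_q a b) +
   line_s_over_q b * ((pz a - py a * line_s_over_q b) - line_s_over_q b / 2)) /
  (line_n_over_q a b ^ 2 + line_s_over_q b ^ 2).

Lemma oloid_curve_n_s c n s : oloid_curve c n s -> 0 < n ^ 2 + s ^ 2.
Proof.
  intros H; pose proof (oloid_curve_bounds _ _ _ H); destruct H; nra.
Qed.

Lemma line_coordinates c n s ya yb :
  oloid_curve c n s -> yb <> 0 ->
  let a := ruling c n s 1 ya in let b := ruling c n s 0 yb in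
  0 < line_n_over_q a b ^ 2 + line_s_over_q b ^ 2 /\ line_cos a b = c /\
  line_n_over_q a b * q c = n /\ line_s_over_q b * q c = s.
Proof.
  intros H Hyb a b; pose proof (q_pos c) as Hq.
  pose proof (oloid_curve_n_s _ _ _ H) as Hns; destruct H as [H1 H2].
  assert (HX : line_n_over_q a b = n / q c).
  { unfold line_n_over_q, a, b, ruling, px, py, pz; cbn [fst snd]; field; lra. }
  assert (HS : line_s_over_q b = s / q c).
  { unfold line_s_over_q, b, ruling, px, py, pz; cbn [fst snd]; field; lra. }
  assert (HXS : line_n_over_q a b ^ 2 + line_s_over_q b ^ 2 = (n ^ 2 + s ^ 2) / q c ^ 2).
  { rewrite HX, HS; field; lra. }
  assert (Hpos : 0 < (n ^ 2 + s ^ 2) / q c ^ 2).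
  { apply Rdiv_lt_0_compat; [lra|]; nra. }
  repeat split.
  - now rewrite HXS.
  - unfold line_cos; rewrite HXS, HX, HS.
    unfold a, b, ruling, px, py, pz; cbn [fst snd]; field.
    repeat split; lra.
  - rewrite HX; field; lra.
  - rewrite HS; field; lra.
Qed.

Lemma ruling_py_nonzero c n s b :
  b = ruling c n s 0 (py b) -> b <> vzero -> py b <> 0.
Proof.
  intros Hb Hnz H0; apply Hnz; rewrite Hb, H0.
  pose proof (q_pos c); unfold vzero; coordinates; field; lra.
Qed.

Lemma oloid_curve_inj c n s c' n' s' a b :
  oloid_curve c n s -> oloid_curve c' n' s' -> b <> vzero ->
  (forall p, line a b p -> p = ruling c n s 1 (py p)) ->
  (forall p, line a b p -> p = ruling c' n' s' 1 (py p)) ->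
  c = c' /\ n = n' /\ s = s'.
Proof.
  intros H H' Hb Hl Hl'.
  apply line_in_ruling in Hl; apply line_in_ruling in Hl'.
  destruct Hl as [Ha1 Hb1], Hl' as [Ha2 Hb2].
  pose proof (ruling_py_nonzero _ _ _ _ Hb1 Hb) as Hy.
  destruct (line_coordinates c n s (py a) (py b) H Hy) as [_ [Hc [Hn Hs]]].
  destruct (line_coordinates c' n' s' (py a) (py b) H' Hy) as [_ [Hc' [Hn' Hs']]].
  rewrite <- Ha1, <- Hb1 in *; rewrite <- Ha2, <- Hb2 in *.
  assert (c = c') by congruence; subst c'.
  repeat split; congruence.
Qed.

Lemma ex_derive_line_n_over_q (ax ay bx by_ : R -> R) x :
  ex_derive ax x -> ex_derive ay x -> ex_derive bx x -> ex_derive by_ x ->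
  by_ x <> 0 ->
  ex_derive (fun u => (2 * (ax u - ay u * (bx u / by_ u)) - bx u / by_ u) / 2) x.
Proof. intros; auto_derive; repeat split; assumption. Qed.

Lemma ex_derive_line_cos (X S ay az bx by_ : R -> R) x :
  ex_derive X x -> ex_derive S x -> ex_derive ay x -> ex_derive az x ->
  ex_derive bx x -> ex_derive by_ x -> by_ x <> 0 -> X x ^ 2 + S x ^ 2 <> 0 ->
  ex_derive (fun u => (X u * (- (bx u / by_ u) - X u) +
    S u * ((az u - ay u * S u) - S u / 2)) / (X u ^ 2 + S u ^ 2)) x.
Proof.
  intros HX HS Hay Haz Hbx Hby Hy H; auto_derive; repeat split; try assumption.
Qed.

(** For each [u] the line has some parameters [(c, n, s)]; that they can be
    differentiated in [u] is due to the rational formulas of [line_coordinates]. *)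
Lemma ruling_parameters_differentiable (a b : R -> point) :
  vC1_near a 0 -> vC1_near b 0 ->
  locally 0 (fun u => b u <> vzero /\ extended_oloid (line (a u) (b u))) ->
  exists c n s : R -> R,
    ex_derive c 0 /\ ex_derive n 0 /\ ex_derive s 0 /\
    locally 0 (fun u => oloid_curve (c u) (n u) (s u) /\
      a u = ruling (c u) (n u) (s u) 1 (py (a u)) /\
      b u = ruling (c u) (n u) (s u) 0 (py (b u))).
Proof.
  intros [Hax [Hay Haz]] [Hbx [Hby Hbz]] HF.
  apply locally_singleton in Hax, Hay, Haz, Hbx, Hby, Hbz.
  destruct Hax as [Hax _], Hay as [Hay _], Haz as [Haz _],
    Hbx as [Hbx _], Hby as [Hby _], Hbz as [Hbz _].
  assert (Hloc : locally 0 (fun u => py (b u) <> 0 /\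
      exists c n s, oloid_curve c n s /\
        a u = ruling c n s 1 (py (a u)) /\ b u = ruling c n s 0 (py (b u)))).
  { revert HF; apply filter_imp; intros u [Hb HL].
    apply extended_oloid_ruling in HL; destruct HL as [c [n [s [H HL]]]].
    destruct (line_in_ruling c n s (a u) (b u)) as [H1 H2]; [apply HL|].
    split; [now apply (ruling_py_nonzero c n s)|now exists c, n, s]. }
  clear HF.
  pose (c := fun u => line_cos (a u) (b u)).
  exists c, (fun u => line_n_over_q (a u) (b u) * q (c u)),
    (fun u => line_s_over_q (b u) * q (c u)).
  assert (Hy0 : py (b 0) <> 0 /\ line_n_over_q (a 0) (b 0) ^ 2 + line_s_over_q (b 0) ^ 2 <> 0).
  { apply locally_singleton in Hloc.
    destruct Hloc as [Hy [c0 [n0 [s0 [H [H1 H2]]]]]]; split; [exact Hy|].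
    rewrite H1, H2.
    destruct (line_coordinates c0 n0 s0 (py (a 0)) (py (b 0)) H Hy); lra. }
  destruct Hy0 as [Hy0 HXS].
  assert (HX : ex_derive (fun u => line_n_over_q (a u) (b u)) 0).
  { apply (ex_derive_line_n_over_q _ _ _ _ 0 Hax Hay Hbx Hby Hy0). }
  assert (HS : ex_derive (fun u => line_s_over_q (b u)) 0).
  { apply (ex_derive_div _ _ 0 Hbz Hby Hy0). }
  assert (Hc : ex_derive c 0).
  { apply (ex_derive_line_cos _ _ _ _ _ _ 0 HX HS Hay Haz Hbx Hby Hy0 HXS). }
  assert (Hq : ex_derive (fun u => q (c u)) 0).
  { unfold q; auto_derive; repeat split; assumption. }
  repeat split; try assumption.
  - apply (ex_derive_mult (fun u => line_n_over_q (a u) (b u))); assumption.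
  - apply (ex_derive_mult (fun u => line_s_over_q (b u))); assumption.
  - revert Hloc; apply filter_imp; intros u [Hy [c0 [n0 [s0 [H [H1 H2]]]]]].
    destruct (line_coordinates c0 n0 s0 (py (a u)) (py (b u)) H Hy)
      as [_ [Hc' [Hn' Hs']]].
    rewrite <- H1, <- H2 in *; unfold c.
    rewrite Hc', Hn', Hs'; tauto.
Qed.

Lemma is_derive_eq (f : R -> R) (x l l' : R) : is_derive f x l -> l = l' -> is_derive f x l'.
Proof. now intros H <-. Qed.

(** The field [(n s, - c s, n)] is tangent to both quadrics and has no zero on
    their intersection, so it spans the tangent line of the curve. *)
Lemma oloid_curve_velocity (c n s : R -> R) :
  ex_derive c 0 -> ex_derive n 0 -> ex_derive s 0 ->
  locally 0 (fun u => oloid_curve (c u) (n u) (s u)) ->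
  exists tau, is_derive c 0 (tau * (n 0 * s 0)) /\
    is_derive n 0 (tau * (- c 0 * s 0)) /\ is_derive s 0 (tau * n 0).
Proof.
  intros Hc Hn Hs H.
  pose proof (locally_singleton _ _ H) as H0.
  pose proof (oloid_curve_n_s _ _ _ H0) as Hns.
  apply Derive_correct in Hc, Hn, Hs.
  set (c' := Derive c 0) in *; set (n' := Derive n 0) in *; set (s' := Derive s 0) in *.
  assert (E1 : 2 * c 0 * c' + 2 * n 0 * n' = 0).
  { transitivity (Derive (fun _ => 1) 0); [|apply Derive_const].
    symmetry; apply is_derive_unique.
    apply is_derive_ext_loc with (fun u => c u ^ 2 + n u ^ 2).
    - revert H; apply filter_imp; intros u [H1 _]; exact H1.
    - auto_derive.
      + repeat split; eexists; eassumption.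
      + fold c' n'; change (Derive (fun x => c x) 0) with c';
        change (Derive (fun x => n x) 0) with n'; ring. }
  assert (E2 : 2 * s 0 * s' - 2 * c' = 0).
  { transitivity (Derive (fun _ => 1) 0); [|apply Derive_const].
    symmetry; apply is_derive_unique.
    apply is_derive_ext_loc with (fun u => s u ^ 2 - 2 * c u).
    - revert H; apply filter_imp; intros u [_ H1]; lra.
    - auto_derive.
      + repeat split; eexists; eassumption.
      + change (Derive (fun x => c x) 0) with c';
        change (Derive (fun x => s x) 0) with s'; ring. }
  assert (Hc' : c' = s 0 * s') by lra.
  destruct (Req_dec (n 0) 0) as [Hn0|Hn0].
  - rewrite Hn0 in *; destruct H0 as [H1 H2].
    assert (Hs0 : s 0 <> 0) by nra.
    assert (Hc0 : c 0 <> 0) by nra.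
    assert (Hc'0 : c' = 0).
    { apply Rmult_eq_reg_l with (2 * c 0); lra. }
    assert (Hs'0 : s' = 0).
    { apply Rmult_eq_reg_l with (s 0); lra. }
    exists (- n' / (c 0 * s 0)); split; [|split].
    + apply (is_derive_eq _ _ _ _ Hc); lra.
    + apply (is_derive_eq _ _ _ _ Hn); field; lra.
    + apply (is_derive_eq _ _ _ _ Hs); lra.
  - exists (s' / n 0); split; [|split].
    + apply (is_derive_eq _ _ _ _ Hc); rewrite Hc'; field; lra.
    + apply (is_derive_eq _ _ _ _ Hn).
      apply Rmult_eq_reg_l with (n 0); [|lra].
      replace (n 0 * n') with (- c 0 * c') by lra; rewrite Hc'; field; lra.
    + apply (is_derive_eq _ _ _ _ Hs); field; lra.
Qed.

(** * Local parameters on the curve of generating lines *)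

Lemma C1_near_intro (f f' : R -> R) (x : R) :
  locally x (fun y => is_derive f y (f' y) /\ continuous f' y) -> C1_near f x.
Proof.
  intros H; apply locally_locally in H; unfold C1_near; revert H; apply filter_imp; intros y H.
  pose proof (locally_singleton _ _ H) as [H1 H2]; split; [now exists (f' y)|].
  apply continuous_ext_loc with f'; [|exact H2].
  revert H; apply filter_imp; intros z [Hz _]; symmetry; now apply is_derive_unique.
Qed.

Lemma C1_near_derive f x :
  C1_near f x ->
  locally x (fun y => is_derive f y (Derive f y) /\ continuous (Derive f) y).
Proof.
  unfold C1_near; apply filter_imp; intros y [H1 H2]; split; [now apply Derive_correct|exact H2].
Qed.

Lemma C1_near_ex_derive f x : C1_near f x -> ex_derive f x.
Proof. intros H; apply locally_singleton in H; tauto. Qed.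

Lemma C1_near_const k x : C1_near (fun _ => k) x.
Proof.
  apply C1_near_intro with (fun _ => 0); apply filter_forall; intros y; split.
  - apply (is_derive_const k).
  - apply continuous_const.
Qed.

Lemma C1_near_id x : C1_near (fun u => u) x.
Proof.
  apply C1_near_intro with (fun _ => 1); apply filter_forall; intros y; split.
  - apply (is_derive_id y).
  - apply continuous_const.
Qed.

Lemma C1_near_plus f g x : C1_near f x -> C1_near g x -> C1_near (fun u => f u + g u) x.
Proof.
  intros Hf Hg; apply C1_near_derive in Hf, Hg.
  apply C1_near_intro with (fun u => Derive f u + Derive g u).
  generalize (filter_and _ _ Hf Hg); apply filter_imp; intros y [[H1 H2] [H3 H4]].
  split.
  - apply (is_derive_plus f g); assumption.
  - apply (continuous_plus (Derive f) (Derive g)); assumption.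
Qed.

Lemma C1_near_mult f g x : C1_near f x -> C1_near g x -> C1_near (fun u => f u * g u) x.
Proof.
  intros Hf Hg; apply C1_near_derive in Hf, Hg.
  apply C1_near_intro with (fun u => Derive f u * g u + f u * Derive g u).
  generalize (filter_and _ _ Hf Hg); apply filter_imp; intros y [[H1 H2] [H3 H4]].
  assert (Cf : continuous f y) by (apply (ex_derive_continuous f); now exists (Derive f y)).
  assert (Cg : continuous g y) by (apply (ex_derive_continuous g); now exists (Derive g y)).
  split.
  - apply (is_derive_mult f g); try assumption; intros; apply Rmult_comm.
  - apply (continuous_plus (fun u => Derive f u * g u) (fun u => f u * Derive g u));
      [apply (continuous_mult (Derive f) g)|apply (continuous_mult f (Derive g))]; assumption.
Qed.

Lemma C1_near_sqrt f x : C1_near f x -> 0 < f x -> C1_near (fun u => sqrt (f u)) x.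
Proof.
  intros Hf Hpos.
  assert (Hp : locally x (fun u => 0 < f u)).
  { apply (ex_derive_continuous f); [now apply C1_near_ex_derive|].
    apply (open_gt 0); exact Hpos. }
  apply C1_near_derive in Hf.
  apply C1_near_intro with (fun u => Derive f u * / (2 * sqrt (f u))).
  generalize (filter_and _ _ Hf Hp); apply filter_imp; intros y [[H1 H2] H3].
  assert (Cf : continuous f y) by (apply (ex_derive_continuous f); now exists (Derive f y)).
  assert (Hs : 0 < sqrt (f y)) by now apply sqrt_lt_R0.
  split.
  - apply (is_derive_comp sqrt f); [|exact H1].
    apply is_derive_Reals; now apply derivable_pt_lim_sqrt.
  - apply (continuous_mult (Derive f) (fun u => / (2 * sqrt (f u)))); [exact H2|].
    apply (continuous_Rinv_comp (fun u => 2 * sqrt (f u))); [|lra].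
    apply (continuous_mult (fun _ => 2) (fun u => sqrt (f u)));
      [apply continuous_const|apply (continuous_comp f sqrt); [exact Cf|apply continuous_sqrt]].
Qed.

Lemma C1_near_cos x : C1_near cos x.
Proof.
  apply C1_near_intro with (fun u => - sin u); apply filter_forall; intros y; split.
  - apply is_derive_cos.
  - apply (continuous_opp sin); apply continuous_sin.
Qed.

Lemma C1_near_sin x : C1_near sin x.
Proof.
  apply C1_near_intro with cos; apply filter_forall; intros y; split.
  - apply is_derive_sin.
  - apply continuous_cos.
Qed.

Ltac C1 :=
  lazymatch goal with
  | |- C1_near (fun _ => ?k) _ => apply C1_near_const
  | |- C1_near (fun u => u) _ => apply C1_near_id
  | |- C1_near (fun u => cos u) _ => apply C1_near_cos
  | |- C1_near (fun u => sin u) _ => apply C1_near_sin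
  | |- C1_near (fun u => @?f u + @?g u) _ => apply (C1_near_plus f g); C1
  | |- C1_near (fun u => @?f u * @?g u) _ => apply (C1_near_mult f g); C1
  | |- C1_near (fun u => sqrt (@?f u)) _ => apply (C1_near_sqrt f); [C1|]
  | |- C1_near _ _ => assumption
  end.

Lemma is_derive_scaled_sqrt k (f : R -> R) (x l : R) :
  f x = 1 -> is_derive f x l -> is_derive (fun u => k * sqrt (f u)) x (k * (l / 2)).
Proof.
  intros Hx Hf; auto_derive.
  - split; [eexists; exact Hf|]; split; [|exact I]; rewrite Hx; lra.
  - rewrite Hx, sqrt_1, (is_derive_unique (fun u : R => f u) _ _ Hf); field.
Qed.

(** Where [s] is nonzero, rotating [(c, n)] by the angle [u] works; where [s = 0],
    and hence [n] is nonzero, [s] itself is a local parameter. *)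
Lemma oloid_curve_chart c n s :
  oloid_curve c n s ->
  exists (C N S : R -> R) (tau : R), tau <> 0 /\
    C 0 = c /\ N 0 = n /\ S 0 = s /\
    C1_near C 0 /\ C1_near N 0 /\ C1_near S 0 /\
    locally 0 (fun u => oloid_curve (C u) (N u) (S u)) /\
    is_derive C 0 (tau * (n * s)) /\
    is_derive N 0 (tau * (- c * s)) /\ is_derive S 0 (tau * n).
Proof.
  intros H; pose proof (oloid_curve_n_s _ _ _ H) as Hns; destruct H as [H1 H2].
  destruct (Req_dec s 0) as [Hs|Hs].
  - assert (Hn : n <> 0) by (intros E; rewrite E, Hs in Hns; lra).
    pose (C := fun u => ((s + u) * (s + u) + -1) * / 2).
    (* [n * sqrt (rho u)] is the root of [1 - C u ^ 2] with the sign of [n]. *)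
    pose (rho := fun u => (1 + -1 * (C u * C u)) * / n ^ 2).
    assert (HC0 : C 0 = c) by (unfold C; nra).
    assert (Hr0 : rho 0 = 1).
    { unfold rho; rewrite HC0; replace (1 + _) with (n ^ 2) by lra; field; exact Hn. }
    assert (HC : C1_near C 0) by (unfold C; C1).
    assert (Hr : C1_near rho 0) by (unfold rho; C1).
    assert (Hrpos : locally 0 (fun u => 0 < rho u)).
    { apply (ex_derive_continuous rho); [now apply C1_near_ex_derive|].
      apply (open_gt 0); rewrite Hr0; lra. }
    exists C, (fun u => n * sqrt (rho u)), (fun u => s + u), (/ n).
    rewrite Hr0, sqrt_1.
    split; [|split; [|split; [|split; [|split; [|split; [|split; [|split; [|split; [|split]]]]]]]]].
    + now apply Rinv_neq_0_compat.
    + exact HC0.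
    + ring.
    + ring.
    + exact HC.
    + C1; lra.
    + C1.
    + revert Hrpos; apply filter_imp; intros u Hu; split.
      * rewrite Rpow_mult_distr, pow2_sqrt by lra; unfold rho; field; exact Hn.
      * unfold C; field.
    + unfold C; auto_derive; [exact I|]; field; exact Hn.
    + apply (is_derive_eq _ _ (n * (- 2 * c * s / n ^ 2 / 2))); [|field; exact Hn].
      apply is_derive_scaled_sqrt; [exact Hr0|].
      unfold rho, C; auto_derive; [exact I|];
      rewrite <- HC0; unfold C; field; exact Hn.
    + auto_derive; [exact I|]; field; exact Hn.
  - pose (C := fun u => c * cos u + -1 * (n * sin u)).
    (* [s * sqrt (rho u)] is the root of [1 + 2 * C u] with the sign of [s]. *)
    pose (rho := fun u => (1 + 2 * C u) * / s ^ 2).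
    assert (HC0 : C 0 = c) by (unfold C; rewrite cos_0, sin_0; ring).
    assert (Hr0 : rho 0 = 1).
    { unfold rho; rewrite HC0, <- H2; field; exact Hs. }
    assert (HC : C1_near C 0) by (unfold C; C1).
    assert (Hr : C1_near rho 0) by (unfold rho; C1).
    assert (Hrpos : locally 0 (fun u => 0 < rho u)).
    { apply (ex_derive_continuous rho); [now apply C1_near_ex_derive|].
      apply (open_gt 0); rewrite Hr0; lra. }
    exists C, (fun u => n * cos u + c * sin u), (fun u => s * sqrt (rho u)), (- / s).
    rewrite Hr0, sqrt_1, cos_0, sin_0.
    split; [|split; [|split; [|split; [|split; [|split; [|split; [|split; [|split; [|split]]]]]]]]].
    + apply Ropp_neq_0_compat; now apply Rinv_neq_0_compat.
    + exact HC0.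
    + ring.
    + ring.
    + exact HC.
    + C1.
    + C1; lra.
    + revert Hrpos; apply filter_imp; intros u Hu; split.
      * pose proof (sin2_cos2 u) as E; unfold Rsqr in E; unfold C.
        transitivity ((c ^ 2 + n ^ 2) * (sin u * sin u + cos u * cos u)); [ring|].
        rewrite H1, E; ring.
      * rewrite Rpow_mult_distr, pow2_sqrt by lra; unfold rho; field; exact Hs.
    + unfold C; auto_derive; [exact I|]; rewrite cos_0, sin_0; field; exact Hs.
    + auto_derive; [exact I|]; rewrite cos_0, sin_0; field; exact Hs.
    + apply (is_derive_eq _ _ (s * (- 2 * n / s ^ 2 / 2))); [|field; exact Hs].
      apply is_derive_scaled_sqrt; [exact Hr0|].
      unfold rho, C; auto_derive; [exact I|]; rewrite cos_0, sin_0; field; exact Hs.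
Qed.

(** * The edge of regression *)

Lemma regression_defect_singular (L : point -> Prop) c n s p :
  oloid_curve c n s -> (forall p, L p <-> p = ruling c n s 1 (py p)) ->
  L p -> regression_defect c (py p) = 0 -> singular_point extended_oloid L p.
Proof.
  intros H HL Hp Hd; split; [exact Hp|].
  intros a b m [Ha [Hb [Hloc HL0]]] Epq.
  destruct (ruling_parameters_differentiable a b Ha Hb Hloc)
    as [C [N [S [HC [HN [HS HCNS]]]]]].
  assert (Hcurve : locally 0 (fun u => oloid_curve (C u) (N u) (S u)))
    by (revert HCNS; apply filter_imp; tauto).
  assert (Hau : locally 0 (fun u => a u = ruling (C u) (N u) (S u) 1 (py (a u))))
    by (revert HCNS; apply filter_imp; tauto).
  assert (Hbu : locally 0 (fun u => b u = ruling (C u) (N u) (S u) 0 (py (b u))))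
    by (revert HCNS; apply filter_imp; tauto).
  destruct (oloid_curve_velocity C N S HC HN HS Hcurve) as [tau [HC' [HN' HS']]].
  assert (H0 := locally_singleton _ _ Hcurve).
  assert (EC : C 0 = c).
  { destruct (locally_singleton _ _ Hloc) as [Hb0 _].
    apply (oloid_curve_inj (C 0) (N 0) (S 0) c n s (a 0) (b 0)); auto.
    - intros r Hr.
      assert (Ha0 := locally_singleton _ _ Hau); assert (Hb0' := locally_singleton _ _ Hbu).
      simpl in Ha0, Hb0'.
      pose proof (ruling_py_nonzero _ _ _ _ Hb0' Hb0) as Hy.
      rewrite Ha0, Hb0' in Hr; exact (proj1 (line_ruling _ _ _ _ _ _ Hy) Hr).
    - intros r Hr; apply HL, HL0, Hr. }
  destruct Ha as [_ [Hay _]], Hb as [_ [Hby _]].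
  rewrite (cross_partial_derivatives a b C N S m tau H0 Hau Hbu
    (C1_near_ex_derive _ _ Hay) (C1_near_ex_derive _ _ Hby) HC' HN' HS').
  assert (Ey : py (a 0) + m * py (b 0) = py p) by (rewrite Epq; reflexivity).
  rewrite EC, Ey, Hd; pose proof (q_pos c).
  unfold vzero; coordinates; field; lra.
Qed.

(** One ruling with nonzero [tau] suffices.  It is built from the unnormalized
    point and direction of the line, which are polynomial in [(c, n, s)] and
    hence C^1. *)
Lemma singular_regression_defect (L : point -> Prop) c n s p :
  oloid_curve c n s -> (forall p, L p <-> p = ruling c n s 1 (py p)) ->
  singular_point extended_oloid L p -> regression_defect c (py p) = 0.
Proof.
  intros H HL [Hp Hsing].
  destruct (oloid_curve_chart c n s H)
    as [C [N [S [tau [Htau [EC [EN [ES [HC [HN [HS [Hcurve [HC' [HN' HS']]]]]]]]]]]]]].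
  pose (a := fun u => (N u, -1 * (/ 2) + -1 * C u, 0) : point).
  pose (b := fun u => (-1 * (N u * (1 + C u)), 1 + C u + C u * C u, S u) : point).
  assert (Ha : forall u, a u = ruling (C u) (N u) (S u) 1 (py (a u))).
  { intros u; pose proof (q_pos (C u)); unfold a, q in *; coordinates; unfold q; field; lra. }
  assert (Hb : forall u, b u = ruling (C u) (N u) (S u) 0 (py (b u))).
  { intros u; pose proof (q_pos (C u)); unfold b, q in *; coordinates; unfold q; field; lra. }
  assert (Hby : forall u, 0 < py (b u)).
  { intros u; pose proof (q_pos (C u)); unfold b, py, q in *; cbn [fst snd]; lra. }
  assert (Hline : forall u p, line (a u) (b u) p <->
      p = ruling (C u) (N u) (S u) 1 (py p)).
  { intros u r; rewrite Ha, Hb; apply line_ruling; specialize (Hby u); lra. }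
  assert (Ha1 : vC1_near a 0).
  { unfold a; repeat split; unfold px, py, pz; cbn [fst snd]; C1. }
  assert (Hb1 : vC1_near b 0).
  { unfold b; repeat split; unfold px, py, pz; cbn [fst snd]; C1. }
  assert (Hr : local_ruling extended_oloid L a b).
  { split; [exact Ha1|split; [exact Hb1|split]].
    - revert Hcurve; apply filter_imp; intros u Hu; split.
      + intros E; specialize (Hby u); rewrite E in Hby.
        unfold vzero, py in Hby; cbn [fst snd] in Hby; lra.
      + apply extended_oloid_ruling; exists (C u), (N u), (S u); auto.
    - intros r; rewrite Hline, EC, EN, ES; symmetry; apply HL. }
  assert (Hm : exists m, p = vadd (a 0) (vscal m (b 0))).
  { apply (Hline 0); rewrite EC, EN, ES; now apply HL. }
  destruct Hm as [m Hm].
  assert (Hcross := Hsing a b m Hr Hm).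
  destruct Ha1 as [_ [Hay _]], Hb1 as [_ [Hby1 _]].
  rewrite (cross_partial_derivatives a b C N S m tau) in Hcross;
    try (rewrite EC, ?EN, ?ES; assumption);
    try (rewrite ?EN, ?ES; assumption);
    try (apply filter_forall; assumption);
    try (apply C1_near_ex_derive; assumption).
  assert (Ey : py (a 0) + m * py (b 0) = py p) by (rewrite Hm; reflexivity).
  rewrite Ey, EC, EN, ES in Hcross.
  pose proof (oloid_curve_n_s _ _ _ H) as Hns; pose proof (q_pos c) as Hq.
  specialize (Hby 0); set (yb := py (b 0)) in *.
  assert (Hx := f_equal px Hcross); assert (Hz := f_equal pz Hcross).
  unfold vzero, vscal, px, pz in Hx, Hz; cbn [fst snd] in Hx, Hz.
  set (k := _ / _) in Hx, Hz.
  assert (Hk : k = 0).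
  { destruct (Req_dec n 0) as [En|En].
    - apply Rmult_integral in Hz; destruct Hz as [Hz|Hz]; [exact Hz|].
      rewrite En, Hz in Hns; lra.
    - apply Rmult_integral in Hx; destruct Hx as [Hx|Hx]; [exact Hx|contradiction]. }
  assert (E : - tau * yb * regression_defect c (py p) = k * (2 * q c ^ 2)).
  { unfold k; field; lra. }
  rewrite Hk, Rmult_0_l in E.
  apply Rmult_integral in E; destruct E as [E|E]; [|exact E].
  apply Rmult_integral in E; destruct E; lra.
Qed.

(** At [c = 0] the defect is 2 at every height, so [c] cannot vanish. *)
Lemma regression_defect_zero c y :
  - (1 / 2) <= c -> regression_defect c y = 0 ->
  c <> 0 /\ y = (2 + 3 * c - 3 * c ^ 2 - 2 * c ^ 3) / (6 * (1 + c) * c).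
Proof.
  unfold regression_defect; intros Hc H.
  assert (Hc0 : c <> 0) by (intros E; rewrite E in H; lra).
  split; [exact Hc0|].
  field_simplify_eq; [lra|split; lra].
Qed.

Lemma regression_defect_g2 t :
  - (2 * PI / 3) <= t <= 2 * PI / 3 -> cos t <> 0 ->
  regression_defect (cos t) (g2 t) = 0.
Proof.
  intros Ht Hc; pose proof (cos_range t Ht); unfold regression_defect, g2.
  field; lra.
Qed.

Lemma g_domain_cos t :
  g_domain t <-> - (2 * PI / 3) <= t <= 2 * PI / 3 /\ cos t <> 0.
Proof.
  pose proof PI_RGT_0 as Hpi; split.
  - intros [Ht [H1 H2]]; split; [exact Ht|].
    destruct (Rlt_dec t (- (PI / 2))) as [Hl|Hl].
    { rewrite <- cos_neg; apply Rlt_not_eq, cos_lt_0; lra. }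
    destruct (Rlt_dec t (PI / 2)) as [Hr|Hr].
    { apply Rgt_not_eq, cos_gt_0; lra. }
    apply Rlt_not_eq, cos_lt_0; lra.
  - intros [Ht Hc]; split; [exact Ht|split]; intros E; apply Hc; rewrite E.
    + apply cos_PI2.
    + rewrite cos_neg; apply cos_PI2.
Qed.

Lemma g_ruling e t :
  (e = 1 \/ e = -1) -> - (2 * PI / 3) <= t <= 2 * PI / 3 -> cos t <> 0 ->
  g e t = ruling (cos t) (sin t) (e * sqrt (1 + 2 * cos t)) 1 (g2 t).
Proof.
  intros He Ht Hc; pose proof (cos_range t Ht) as Hc'.
  pose proof (q_pos (cos t)) as Hq; unfold q in Hq.
  pose proof (sqrt_sqrt (1 + 2 * cos t)) as Hr.
  unfold g, g1, g2, g3, tan; coordinates; unfold q.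
  - field; lra.
  - reflexivity.
  - replace (sqrt (1 + 2 * cos t) ^ 3) with
      ((1 + 2 * cos t) * sqrt (1 + 2 * cos t)) by (rewrite <- Hr at 1; [ring|lra]).
    field; lra.
Qed.

Lemma singular_point_g e t :
  (e = 1 \/ e = -1) -> g_domain t ->
  singular_point extended_oloid (generator e t) (g e t).
Proof.
  intros He Ht; apply g_domain_cos in Ht; destruct Ht as [Ht Hc].
  assert (HL := fun p => generator_ruling e t p Ht He).
  apply (regression_defect_singular _ _ _ _ _ (oloid_curve_param e t He Ht) HL).
  - apply HL; rewrite (g_ruling e t He Ht Hc) at 1; reflexivity.
  - now apply regression_defect_g2.
Qed.

Lemma edge_of_regression_extended_oloid p :
  edge_of_regression extended_oloid p <->
  exists e t : R, (e = 1 \/ e = -1) /\ g_domain t /\ p = g e t.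
Proof.
  split.
  - intros [L [[e [t [He [Ht HL]]]] Hs]]; exists e, t; split; [exact He|].
    assert (HL' : forall p, L p <->
        p = ruling (cos t) (sin t) (e * sqrt (1 + 2 * cos t)) 1 (py p))
      by (intros r; rewrite HL; now apply generator_ruling).
    assert (Hd := singular_regression_defect L _ _ _ p
      (oloid_curve_param e t He Ht) HL' Hs).
    destruct (regression_defect_zero _ _ (cos_range t Ht) Hd) as [Hc Hy].
    split; [now apply g_domain_cos|].
    rewrite (g_ruling e t He Ht Hc); unfold g2; rewrite <- Hy.
    apply HL'; apply Hs.
  - intros [e [t [He [Ht ->]]]]; exists (generator e t); split.
    + exists e, t; split; [exact He|split; [apply Ht|reflexivity]].
    + now apply singular_point_g.
Qed.

(** * Tangents of the edge of regression *)

(** At [0] because [h^(3/2) = o(h)], and [sqrt] vanishes on negative numbers. *)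
Lemma is_derive_sqrt_cube x :
  0 <= x -> is_derive (fun u => sqrt u ^ 3) x (3 / 2 * sqrt x).
Proof.
  intros [Hx|Hx].
  - auto_derive; [exact Hx|].
    assert (0 < sqrt x) by now apply sqrt_lt_R0.
    field; lra.
  - subst x; rewrite sqrt_0; apply is_derive_Reals; intros eps Heps.
    exists (mkposreal (eps ^ 2) (pow_lt eps 2 Heps)); intros h Hh Hd; simpl in Hd.
    rewrite Rplus_0_l, sqrt_0; destruct (Rle_dec h 0) as [Hneg|Hpos].
    + rewrite (sqrt_neg_0 h) by exact Hneg.
      replace (_ - _) with 0 by (field; exact Hh); now rewrite Rabs_R0.
    + pose proof (sqrt_sqrt h) as Hs.
      replace (_ - _) with (sqrt h).
      * rewrite Rabs_right by (apply Rle_ge, sqrt_pos).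
        rewrite Rabs_right in Hd by lra.
        rewrite <- (sqrt_pow2 eps) by lra; apply sqrt_lt_1; nra.
      * field_simplify_eq; [|exact Hh]; rewrite <- Hs at 2 by lra; ring.
Qed.

Lemma is_derive_remainder (f : R -> R) (x l eps : R) :
  is_derive f x l -> 0 < eps ->
  locally x (fun y => Rabs (f y - f x - (y - x) * l) <= eps * Rabs (y - x)).
Proof.
  intros [_ H] He.
  exact (H x (fun P HP => HP) (mkposreal eps He)).
Qed.

Lemma is_derive_secant_large (h : R -> R) (x l : R) :
  is_derive h x l -> l <> 0 ->
  locally x (fun y => Rabs l / 2 * Rabs (y - x) <= Rabs (h y - h x)).
Proof.
  intros Hh Hl; pose proof (Rabs_pos_lt l Hl) as Hl'.
  assert (H := is_derive_remainder h x l (Rabs l / 2) Hh ltac:(lra)); revert H.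
  apply filter_imp; intros y H.
  pose proof (Rabs_triang_inv ((y - x) * l) (- (h y - h x - (y - x) * l))) as T.
  replace (_ - - _) with (h y - h x) in T by ring.
  rewrite Rabs_Ropp, Rabs_mult in T; lra.
Qed.

(** A first-order small quantity is also small relative to the increment of a
    function with nonzero derivative: increments are compared with that of the
    second coordinate. *)
Lemma is_derive_secant_small (F h : R -> R) (x l eps : R) :
  is_derive F x 0 -> is_derive h x l -> l <> 0 -> 0 < eps ->
  locally x (fun y => Rabs (F y - F x) <= eps * Rabs (h y - h x)).
Proof.
  intros HF Hh Hl He.
  assert (Hl' : 0 < Rabs l / 2) by (pose proof (Rabs_pos_lt l Hl); lra).
  generalize (filter_and _ _ (is_derive_remainder F x 0 (eps * (Rabs l / 2)) HF
                (Rmult_lt_0_compat _ _ He Hl')) (is_derive_secant_large h x l Hh Hl)).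
  apply filter_imp; intros y [H1 H2].
  rewrite Rmult_0_r, Rminus_0_r in H1.
  apply Rle_trans with (1 := H1); rewrite Rmult_assoc.
  apply Rmult_le_compat_l; lra.
Qed.

Definition height (c : R) : R :=
  (2 + 3 * c - 3 * c ^ 2 - 2 * c ^ 3) / (6 * (1 + c) * c).

(** The numerator of the derivative is minus a perfect square, so the height of
    the regression point has nonzero derivative in [c]. *)
Lemma is_derive_height c :
  - (1 / 2) <= c -> c <> 0 ->
  is_derive height c (- q c ^ 2 / (3 * c ^ 2 * (1 + c) ^ 2)).
Proof.
  intros Hc Hc0; unfold height, q; auto_derive.
  - intros E; apply Rmult_integral in E; lra.
  - field; lra.
Qed.

Lemma height_slope_neq_0 c :
  - (1 / 2) <= c -> c <> 0 -> - q c ^ 2 / (3 * c ^ 2 * (1 + c) ^ 2) <> 0.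
Proof.
  intros Hc Hc0; pose proof (q_pos c) as Hq.
  assert (0 < c ^ 2) by (apply pow2_gt_0; exact Hc0).
  assert (0 < q c ^ 2 / (3 * c ^ 2 * (1 + c) ^ 2))
    by (apply Rdiv_lt_0_compat; [nra|apply Rmult_lt_0_compat; nra]).
  unfold Rdiv in *; lra.
Qed.

(** The hypothesis on [k] says that the derivative of [r^(3/2) / (3 c (1 + c))] is
    [k * sqrt r] times that of [height].  It is met by [r = 1 - c^2] with
    [k = (1 + c) / q c], and by [r = 1 + 2 c] with [k = 1 / q c]: up to sign,
    [k * sqrt r] is then a coordinate of the direction of the line. *)
Lemma is_derive_cube_ratio (r : R -> R) (c r' k : R) :
  - (1 / 2) <= c -> c <> 0 -> 0 <= r c -> is_derive r c r' ->
  3 * r' * c * (1 + c) / 2 - (1 + 2 * c) * r c = - k * q c ^ 2 ->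
  is_derive (fun u => sqrt (r u) ^ 3 / (3 * (1 + u) * u) - k * sqrt (r c) * height u) c 0.
Proof.
  intros Hc Hc0 Hr Hd Hk; pose proof (q_pos c) as Hq.
  assert (Hden : 3 * (1 + c) * c <> 0)
    by (intros E; apply Rmult_integral in E; lra).
  assert (D1 : is_derive (fun u => sqrt (r u) ^ 3) c (r' * (3 / 2 * sqrt (r c))))
    by (apply (is_derive_comp (fun v => sqrt v ^ 3) r); [now apply is_derive_sqrt_cube|exact Hd]).
  assert (D2 : is_derive (fun u => 3 * (1 + u) * u) c (3 + 6 * c))
    by (auto_derive; [exact I|ring]).
  apply (is_derive_eq _ _ _ _ (is_derive_minus _ _ _ _ _
    (is_derive_div _ _ _ _ _ D1 D2 Hden)
    (is_derive_scal _ _ (k * sqrt (r c)) _ (is_derive_height c Hc Hc0)))).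
  unfold minus, plus, opp; simpl.
  pose proof (sqrt_sqrt _ Hr) as Hs; set (w := sqrt (r c)) in *.
  replace (w * (w * (w * 1))) with (r c * w) by (rewrite <- Hs; ring).
  transitivity (w * (3 * r' * c * (1 + c) / 2 - (1 + 2 * c) * r c - - k * q c ^ 2)
                / (3 * c ^ 2 * (1 + c) ^ 2)).
  - field; lra.
  - rewrite Hk; field; lra.
Qed.

Lemma cos_continuous_locally (P : R -> Prop) t :
  locally (cos t) P -> locally t (fun u => P (cos u)).
Proof. apply continuous_cos. Qed.

Lemma cos_neq_same_sign t t' :
  - PI <= t <= PI -> - PI <= t' <= PI -> 0 <= t * t' -> t <> t' -> cos t <> cos t'.
Proof.
  intros Ht Ht' Hs Hne.
  assert (Hinj : forall v v', 0 <= v <= PI -> 0 <= v' <= PI -> v < v' -> cos v <> cos v').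
  { intros v v' Hv Hv' Hlt; apply Rgt_not_eq, cos_decreasing_1; lra. }
  assert (Hinj' : forall v v', 0 <= v <= PI -> 0 <= v' <= PI -> v <> v' -> cos v <> cos v').
  { intros v v' Hv Hv' Hd; destruct (Rlt_dec v v').
    - now apply Hinj.
    - apply not_eq_sym, Hinj; lra. }
  destruct (Rle_dec 0 t) as [H0|H0].
  - destruct (Rle_dec 0 t') as [H0'|H0'].
    + apply Hinj'; lra.
    + rewrite <- (cos_neg t').
      assert (t = 0) by nra; apply Hinj'; lra.
  - assert (t' <= 0) by nra.
    rewrite <- (cos_neg t), <- (cos_neg t'); apply Hinj'; lra.
Qed.

Lemma locally_same_sign t : locally t (fun u => 0 <= u * t).
Proof.
  destruct (Req_dec t 0) as [->|Ht].
  - apply filter_forall; intros u; lra.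
  - apply (filter_imp (fun u => 0 < u * t)); [intros; lra|].
    assert (Hcont : continuous (fun u => u * t) t)
      by (apply (ex_derive_continuous (fun u => u * t)); auto_derive; exact I).
    apply (Hcont (fun v => 0 < v)), (open_gt 0); nra.
Qed.

Lemma sin_same_sign t t' :
  - PI <= t <= PI -> - PI <= t' <= PI -> 0 <= t * t' -> 0 <= sin t * sin t'.
Proof.
  intros Ht Ht' Hs.
  assert (Hpos : forall v, 0 <= v <= PI -> 0 <= sin v) by (intros; apply sin_ge_0; lra).
  assert (Hneg : forall v, - PI <= v <= 0 -> sin v <= 0).
  { intros v Hv; assert (H := Hpos (- v)); rewrite sin_neg in H; lra. }
  destruct (Rle_dec 0 t) as [H0|H0].
  - destruct (Rle_dec 0 t') as [H0'|H0'].
    + pose proof (Hpos t); pose proof (Hpos t'); nra.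
    + assert (t = 0) by nra; subst t; rewrite sin_0; lra.
  - assert (t' <= 0) by nra; pose proof (Hneg t); pose proof (Hneg t'); nra.
Qed.

Lemma sqrt_one_minus_cos2 t : sqrt (1 - cos t ^ 2) = Rabs (sin t).
Proof.
  rewrite <- sqrt_Rsqr_abs; f_equal.
  pose proof (sin2_cos2 t); unfold Rsqr in *; lra.
Qed.

Lemma g1_cube t : cos t <> 0 -> 1 + cos t <> 0 ->
  g1 t = - (sin t ^ 3 / (3 * (1 + cos t) * cos t)).
Proof.
  intros Hc Hc1; pose proof (sin2_cos2 t) as H; unfold Rsqr in H.
  replace (sin t ^ 3) with (sin t * (1 - cos t * cos t))
    by (rewrite <- H; ring).
  unfold g1, tan; field; tauto.
Qed.

(** Near [t0] the sign of [sin t] is that of [sin t0], which turns [g1] into a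
    function of [cos t].  At the cusp [t0 = 0] the sign is not constant, but
    there [g1 t0] and the slope vanish and only the absolute value matters. *)
Lemma g1_secant t0 eps :
  g_domain t0 -> 0 < eps ->
  locally t0 (fun t => g_domain t ->
    Rabs (g1 t - g1 t0 + (sin t0 * (1 + cos t0) / q (cos t0)) * (g2 t - g2 t0))
    <= eps * Rabs (g2 t - g2 t0)).
Proof.
  intros Ht0 He; pose proof (proj1 (g_domain_cos t0) Ht0) as [Hr0 Hc0].
  pose proof (cos_range t0 Hr0) as Hb0; pose proof PI_RGT_0 as Hpi.
  pose proof (q_pos (cos t0)) as Hq.
  pose (k := (1 + cos t0) / q (cos t0)).
  pose proof (COS_bound t0) as Hb1.
  pose (F := fun u => sqrt (1 - u ^ 2) ^ 3 / (3 * (1 + u) * u)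
                      - k * sqrt (1 - cos t0 ^ 2) * height u).
  assert (HF : is_derive F (cos t0) 0).
  { apply (is_derive_cube_ratio (fun u => 1 - u ^ 2) (cos t0) (- (2 * cos t0)));
      try assumption.
    - nra.
    - auto_derive; [exact I|ring].
    - unfold k, q in *; field; lra. }
  generalize (filter_and _ _ (locally_same_sign t0) (cos_continuous_locally _ t0
    (is_derive_secant_small F height _ _ eps HF (is_derive_height _ Hb0 Hc0)
      (height_slope_neq_0 _ Hb0 Hc0) He))).
  apply filter_imp; intros t [Hs Hsmall] Ht.
  apply g_domain_cos in Ht; destruct Ht as [Hr Hc]; pose proof (cos_range t Hr) as Hb.
  change (height (cos t)) with (g2 t) in Hsmall.
  change (height (cos t0)) with (g2 t0) in Hsmall.
  apply Rle_trans with (2 := Hsmall); apply Req_le.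
  rewrite (g1_cube t), (g1_cube t0) by lra.
  assert (Hss : 0 <= sin t * sin t0) by (apply sin_same_sign; lra).
  unfold F; rewrite !sqrt_one_minus_cos2.
  change (height (cos t)) with (g2 t); change (height (cos t0)) with (g2 t0).
  replace (sin t0 * (1 + cos t0) / q (cos t0)) with (k * sin t0) by (unfold k; field; lra).
  destruct (Rtotal_order (sin t0) 0) as [Hn|[Hn|Hn]].
  - assert (sin t <= 0) by nra.
    rewrite !(Rabs_left1 (sin _)) by lra; f_equal; field; lra.
  - rewrite Hn, Rabs_R0.
    assert (H3 : Rabs (sin t) ^ 3 = Rabs (sin t ^ 3)) by apply RPow_abs.
    rewrite H3.
    replace (0 ^ 3) with 0 by ring.
    destruct (Rle_dec 0 (sin t ^ 3)) as [Hp|Hp].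
    + rewrite (Rabs_right (sin t ^ 3)) by lra.
      rewrite <- Rabs_Ropp; f_equal; field; lra.
    + rewrite (Rabs_left (sin t ^ 3)) by lra; f_equal; field; lra.
  - assert (0 <= sin t) by nra.
    rewrite !(Rabs_right (sin _)) by lra.
    rewrite <- Rabs_Ropp; f_equal; field; lra.
Qed.

Lemma g3_secant t0 eps :
  g_domain t0 -> 0 < eps ->
  locally t0 (fun t =>
    Rabs (g3 t - g3 t0 - (sqrt (1 + 2 * cos t0) / q (cos t0)) * (g2 t - g2 t0))
    <= eps * Rabs (g2 t - g2 t0)).
Proof.
  intros Ht0 He; pose proof (proj1 (g_domain_cos t0) Ht0) as [Hr0 Hc0].
  pose proof (cos_range t0 Hr0) as Hb0; pose proof (q_pos (cos t0)) as Hq.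
  pose (F := fun u => sqrt (1 + 2 * u) ^ 3 / (3 * (1 + u) * u)
                      - / q (cos t0) * sqrt (1 + 2 * cos t0) * height u).
  assert (HF : is_derive F (cos t0) 0).
  { apply (is_derive_cube_ratio (fun u => 1 + 2 * u) (cos t0) 2); try assumption.
    - lra.
    - auto_derive; [exact I|ring].
    - unfold q in *; field; lra. }
  generalize (cos_continuous_locally _ t0
    (is_derive_secant_small F height _ _ eps HF (is_derive_height _ Hb0 Hc0)
      (height_slope_neq_0 _ Hb0 Hc0) He)).
  apply filter_imp; intros t Hsmall.
  apply Rle_trans with (2 := Hsmall); apply Req_le; f_equal.
  unfold F, g3; change (height (cos t)) with (g2 t); change (height (cos t0)) with (g2 t0).
  unfold Rdiv; ring.
Qed.

(** Write [D = py D * d + (E1, 0, E2)]; then [D x d = (E1, 0, E2) x d], of squared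
    norm at most [K * (E1^2 + E2^2)] by the Cauchy-Schwarz inequality. *)
Lemma vnorm_cross_secant (D d : point) (eps : R) :
  py d = 1 -> 0 < eps ->
  let K := 1 + px d ^ 2 + pz d ^ 2 in
  Rabs (px D - px d * py D) <= eps / (2 * K) * Rabs (py D) ->
  Rabs (pz D - pz d * py D) <= eps / (2 * K) * Rabs (py D) ->
  vnorm (cross D d) <= eps * vnorm D.
Proof.
  destruct D as [[x y] z], d as [[al w] be].
  unfold vnorm, cross, px, py, pz; cbn [fst snd]; intros -> He.
  set (K := 1 + al ^ 2 + be ^ 2); cbv zeta.
  assert (HK : 1 <= K) by (unfold K; pose proof (pow2_ge_0 al); pose proof (pow2_ge_0 be); lra).
  set (E1 := x - al * y); set (E2 := z - be * y); intros H1 H2.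
  assert (Hsq : forall E, Rabs E <= eps / (2 * K) * Rabs y ->
      E ^ 2 <= eps ^ 2 / (4 * K ^ 2) * y ^ 2).
  { intros E HE; rewrite <- (pow2_abs E), <- (pow2_abs y).
    replace (eps ^ 2 / (4 * K ^ 2) * Rabs y ^ 2) with ((eps / (2 * K) * Rabs y) ^ 2)
      by (field; lra).
    apply pow_incr; split; [apply Rabs_pos|exact HE]. }
  apply Hsq in H1; apply Hsq in H2.
  replace (eps * sqrt (x ^ 2 + y ^ 2 + z ^ 2))
    with (sqrt (eps ^ 2 * (x ^ 2 + y ^ 2 + z ^ 2)))
    by (rewrite sqrt_mult_alt by apply pow2_ge_0; rewrite sqrt_pow2 by lra; reflexivity).
  apply sqrt_le_1_alt.
  apply Rle_trans with (K * (E1 ^ 2 + E2 ^ 2)).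
  - replace (y * be - z * 1) with (- E2) by (unfold E2; ring).
    replace (z * al - x * be) with (al * E2 - be * E1) by (unfold E1, E2; ring).
    replace (x * 1 - y * al) with E1 by (unfold E1; ring).
    pose proof (pow2_ge_0 (al * E1 + be * E2)); unfold K; nra.
  - apply Rle_trans with (eps ^ 2 * y ^ 2).
    + apply Rle_trans with (K * (2 * (eps ^ 2 / (4 * K ^ 2) * y ^ 2))).
      * apply Rmult_le_compat_l; lra.
      * replace (K * _) with (/ (2 * K) * (eps ^ 2 * y ^ 2)) by (field; lra).
        rewrite <- (Rmult_1_l (eps ^ 2 * y ^ 2)) at 2.
        apply Rmult_le_compat_r; [nra|].
        rewrite <- Rinv_1; apply Rinv_le_contravar; lra.
    + apply Rmult_le_compat_l; nra.
Qed.

Lemma tangent_line_generator e t0 :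
  (e = 1 \/ e = -1) -> g_domain t0 -> tangent_line g_domain (g e) t0 (generator e t0).
Proof.
  intros He Ht0; pose proof (proj1 (g_domain_cos t0) Ht0) as [Hr0 Hc0].
  pose proof (cos_range t0 Hr0) as Hb0; pose proof (q_pos (cos t0)) as Hq.
  pose proof PI_RGT_0 as Hpi.
  pose (d := ruling (cos t0) (sin t0) (e * sqrt (1 + 2 * cos t0)) 0 1).
  exists d; split; [|split].
  - intros E; apply (f_equal py) in E; unfold d, ruling, vzero, py in E; cbn in E; lra.
  - intros p; rewrite (generator_ruling e t0 p Hr0 He), (g_ruling e t0 He Hr0 Hc0).
    symmetry; apply line_ruling; lra.
  - intros eps Heps.
    set (K := 1 + px d ^ 2 + pz d ^ 2).
    assert (HK : 0 < K).
    { unfold K; pose proof (pow2_ge_0 (px d)); pose proof (pow2_ge_0 (pz d)); lra. }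
    assert (Heta : 0 < eps / (2 * K)) by (apply Rdiv_lt_0_compat; lra).
    destruct (filter_and _ _ (locally_same_sign t0) (filter_and _ _
        (cos_continuous_locally _ t0 (is_derive_secant_large height _ _
          (is_derive_height _ Hb0 Hc0) (height_slope_neq_0 _ Hb0 Hc0)))
        (filter_and _ _ (g1_secant t0 _ Ht0 Heta) (g3_secant t0 _ Ht0 Heta))))
      as [delta Hdelta].
    exists delta; split; [apply cond_pos|]; intros t Ht [Hne Hlt].
    destruct (Hdelta t Hlt) as [Hs [Hlarge [H1 H3]]]; specialize (H1 Ht).
    change (height (cos t)) with (g2 t) in Hlarge.
    change (height (cos t0)) with (g2 t0) in Hlarge.
    split.
    + intros E; apply (f_equal py) in E; unfold g, py in E; cbn [fst snd] in E.
      rewrite E, Rminus_diag, Rabs_R0 in Hlarge.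
      assert (Hcos : cos t <> cos t0).
      { destruct Ht as [Ht _]; apply cos_neq_same_sign; try lra.
        intros Et; rewrite Et, Rminus_diag, Rabs_R0 in Hne; lra. }
      pose proof (Rabs_pos_lt _ (height_slope_neq_0 _ Hb0 Hc0)).
      assert (0 < Rabs (cos t - cos t0)) by (apply Rabs_pos_lt; lra).
      nra.
    + apply vnorm_cross_secant; [reflexivity|exact Heps| |]; fold K.
      * apply Rle_trans with (2 := H1); apply Req_le; f_equal.
        unfold d, g; unfold ruling, vsub, px, py, pz; cbn [fst snd]; field; lra.
      * apply Rle_trans with (2 := H3); apply Req_le.
        transitivity (Rabs (e * (g3 t - g3 t0
          - sqrt (1 + 2 * cos t0) / q (cos t0) * (g2 t - g2 t0)))).
        -- f_equal; unfold d, g; unfold ruling, vsub, px, py, pz; cbn [fst snd]; field; lra.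
        -- rewrite Rabs_mult; replace (Rabs e) with 1; [ring|].
           destruct He as [-> | ->]; [rewrite Rabs_R1|rewrite Rabs_left by lra]; ring.
Qed.

Theorem theorem2 :
  (forall p : point,
     edge_of_regression extended_oloid p <->
     exists e t : R, (e = 1 \/ e = -1) /\ g_domain t /\ p = g e t) /\
  (forall e t : R, (e = 1 \/ e = -1) -> g_domain t ->
     singular_point extended_oloid (generator e t) (g e t) /\
     tangent_line g_domain (g e) t (generator e t)).
Proof.
  split; [exact edge_of_regression_extended_oloid|].
  intros e t He Ht; split; [now apply singular_point_g|].
  now apply tangent_line_generator.
Qed.
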